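(* Let $\mathbf X$ be a stationary ergodic process on $\mathcal A=\{0,1\}$ that is non-null and has summable continuity rate, and let $\mathbf Z$ be its zero-inflated contamination $Z_t=X_t\cdot\xi_t$ with noise parameter $\varepsilon$. Then, for any $\varepsilon\in(0,1)$, $$\sup_{k\ge 1}\ \sup_{\omega_{-k}^{-1}\in\mathcal A_{-k}^{-1}}\ \sup_{a\in\mathcal A}\left|p_Z\left(a|\omega_{-k}^{-1}\right)-p_X\left(a|\omega_{-k}^{-1}\right)\right|\le \varepsilon\left[1+\frac{4\beta_X}{\min\left(1,(1+\varepsilon)\alpha_X\beta_X^*\right)}\right],$$ where $\beta_X^*=\prod_{k=0}^{+\infty}(1-\beta_{k,X})>0$.
   Context: $\mathcal A_{-k}^{-1}$ is the set of strings $\omega_{-k}^{-1}=\omega_{-k}\ldots\omega_{-1}$ over $\mathcal A$ and $\mathcal A_{-\infty}^{-1}$ the set of semi-infinite pasts $\ldots\omega_{-2}\omega_{-1}$. For a stationary process $\mathbf X=(X_t)_{t\in\mathbb Z}$ on $\mathcal A$, $p_X(a|\omega)=\mathbb P(X_0=a|X_{-1}=\omega_{-1},X_{-2}=\omega_{-2},\ldots)$ for $\omega\in\mathcal A_{-\infty}^{-1}$, and for a finite string $p_X(a|\omega_{-k}^{-1})=\mathbb P(X_0=a|X_{-k}^{-1}=\omega_{-k}^{-1})$; similarly $p_Z(a|\omega_{-k}^{-1})=\mathbb P(Z_0=a|Z_{-k}^{-1}=\omega_{-k}^{-1})$. Non-null: $\alpha_X:=\inf\{p_X(a|\omega):a\in\mathcal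 A,\ \omega\in\mathcal A_{-\infty}^{-1}\}>0$. Summable continuity rate: $\beta_X:=\sum_{k\in\mathbb N}\beta_{k,X}<\infty$ with $\mathbb N=\{0,1,2,\ldots\}$, where $\beta_{k,X}:=\sup\{|1-p_X(a|\omega)/p_X(a|v)|: a\in\mathcal A,\ \omega,v\in\mathcal A_{-\infty}^{-1},\ \omega_{-k}^{-1}=v_{-k}^{-1}\}$ (no constraint on $\omega,v$ when $k=0$). The positivity $\beta_X^*>0$ is a standing condition. Zero-inflated contamination: $(\xi_t)_{t\in\mathbb Z}$ are i.i.d. $\{0,1\}$-valued, independent of $\mathbf X$, with $\mathbb P(\xi_t=1)=1-\varepsilon$, and $Z_t=X_t\cdot\xi_t$ for all $t\in\mathbb Z$.
   Formalization: Positivity of the product β_X^* is read as including its factors: β_{k,X}<1 is assumed for every k, since with an even number of negative factors 1−β_{k,X} the stated inequality can fail. *)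

(* Defs.v *)
From HB Require Import structures.
From mathcomp Require Export all_boot all_order all_algebra.
From mathcomp Require Export all_classical all_reals all_analysis.

Set Implicit Arguments.
Unset Strict Implicit.
Unset Printing Implicit Defensive.

Import Order.TTheory GRing.Theory Num.Theory.

Local Open Scope classical_set_scope.
Local Open Scope ring_scope.

(* The alphabet {0,1} is bool, with its discrete sigma-algebra; multiplication
   on {0,1} is andb. *)

Definition cylinders (I : Type) : set (set (I -> bool)) :=
  [set C | exists i b, C = [set w | w i = b]].
Arguments cylinders I : clear implicits.

(* The space of I-indexed binary families, with the product sigma-algebra. *)
Notation binspace I := (g_sigma_algebraType (cylinders I)).

(* A semi-infinite past ... w_{-2} w_{-1} is encoded by i |-> w_{-(i+1)}, and a
   string w_{-k} ... w_{-1} by the k-tuple whose i-th entry is w_{-(i+1)}. *)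
Notation pasts := (binspace nat).

Section Process.
Context (d : measure_display) (T : measurableType d) (R : realType).
Variable P : probability T R.

Definition trajectory (Y : int -> T -> bool) (x : T) : binspace int :=
  fun t => Y t x.

Definition past (Y : int -> T -> bool) (x : T) : pasts :=
  fun i => Y (- i.+1%:Z) x.

Definition shift (w : binspace int) : binspace int := fun t => w (t + 1).

Definition stationary (Y : int -> T -> bool) : Prop :=
  forall B : set (binspace int), measurable B ->
    P (trajectory Y @^-1` (shift @^-1` B)) = P (trajectory Y @^-1` B).

Definition ergodic (Y : int -> T -> bool) : Prop :=
  forall B : set (binspace int), measurable B -> shift @^-1` B = B ->
    P (trajectory Y @^-1` B) = 0%E \/ P (trajectory Y @^-1` B) = 1%E.

Definition mutually_independent (Y : int -> T -> bool) : Prop :=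
  forall (s : seq int) (A : int -> set bool), uniq s ->
    P [set x | forall t, t \in s -> A t (Y t x)] =
      (\prod_(t <- s) P (Y t @^-1` A t))%E.

Definition independent_processes (Y W : int -> T -> bool) : Prop :=
  forall B C : set (binspace int), measurable B -> measurable C ->
    P ((trajectory Y @^-1` B) `&` (trajectory W @^-1` C)) =
      (P (trajectory Y @^-1` B) * P (trajectory W @^-1` C))%E.

Definition zero_inflated (Y xi : int -> T -> bool) : int -> T -> bool :=
  fun t x => Y t x && xi t x.

(* p(w){a} is a version of the probability that Y_0 = a given the whole past. *)
Definition is_cond_law (Y : int -> T -> bool) (p : R.-pker pasts ~> bool) :
    Prop :=
  forall (a : bool) (B : set pasts), measurable B ->
    P ((Y 0 @^-1` [set a]) `&` (past Y @^-1` B)) =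
      (\int[P]_(x in past Y @^-1` B) p (past Y x) [set a])%E.

Definition past_is (Y : int -> T -> bool) (k : nat) (w : k.-tuple bool) :
    set T :=
  [set x | forall i : 'I_k, past Y x i = tnth w i].

Definition cond_prob (Y : int -> T -> bool) (k : nat) (w : k.-tuple bool)
    (a : bool) : R :=
  fine (P ((Y 0 @^-1` [set a]) `&` past_is Y w)) / fine (P (past_is Y w)).

End Process.

Section Rates.
Context (R : realType).
Variable p : R.-pker pasts ~> bool.

Definition trans (a : bool) (w : pasts) : R := fine (p w [set a]).

Definition alpha : R := inf [set y | exists a w, y = trans a w].

Definition beta_ (k : nat) : R :=
  sup [set y | exists (a : bool) (w v : pasts),
    (forall i, (i < k)%N -> w i = v i) /\ y = `|1 - trans a w / trans a v|].

Definition beta : \bar R := (\sum_(0 <= k <oo) (beta_ k)%:E)%E.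

(* The terms beta_ k may exceed 1, so an even number of factors could be
   negative while the limit is positive: positivity of the infinite product,
   factors included, is [forall k, beta_ k < 1] together with
   [0 < beta_star]. *)
Definition beta_star : R :=
  limn (fun n => \prod_(0 <= k < n) (1 - beta_ k)).

End Rates.

(* Main.v *)
Require Import Defs.
From mathcomp Require Import all_boot all_order all_algebra.
From mathcomp Require Import all_classical all_reals all_analysis.
From mathcomp Require Import measurable_realfun ring lra.

(** Write mu for the law of finite strings of X, nu for that of Z, and list a
    string with its most recent symbol first.  Since X and the noise are
    independent, nu(w) is the sum over u of mu(u) kappa(u, w), where kappa(u, w)
    is the probability that the noise turns u into w ([thin_prob],
    [string_prob_zero_inflated]).

    The symbol Z_0 = 1 requires X_0 = 1 and the noise at time 0, which is
    independent of everything else, to be 1.  Hence p_Z(1|w) is (1 - eps) times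
    the probability q of X_0 = 1 given that the past of Z is w, and
    |p_Z(1|w) - p_X(1|w)| <= eps + (1 - eps) |q - p_X(1|w)|.  The symbol 0 gives
    the same difference.

    Given that the past of Z is w, the past of X is a random string u, and q is
    the mean of p_X(1|u).  If u and w first differ at distance j, then
    |p_X(1|u) - p_X(1|w)| <= beta_j; a fortiori the difference is at most the sum
    of the beta_j over all j at which u and w differ ([dist_next_prob_sum]).  So
    |q - p_X(1|w)| is at most the sum of beta_j times the probability that u and
    w differ at j, and it remains to bound that probability by
    eps / (alpha beta_star) ([thinned_law_mismatch]).

    Two strings differ at j only where X is 1 and Z is 0.  Resetting this 1 to 0
    removes one factor eps from kappa, and it changes mu by a bounded factor:
    writing mu as a product of conditional probabilities, the factor at position
    j is at least alpha after the change, the factors of the older symbols do not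
    change, and the factor of the symbol i + 1 steps later is multiplied by at least
    1 - beta_i, since its past is changed only beyond its i most recent symbols
    ([mu_flip]).  Hence mu(u) <= mu(flip j u) / (alpha beta_star), and summing
    over u gives the bound.

    In total |p_Z - p_X| <= eps (1 + (1 - eps) beta / (alpha beta_star)), and
    (1 - eps) (1 + eps) <= 1 <= 4. *)

Set Implicit Arguments.
Unset Strict Implicit.
Unset Printing Implicit Defensive.

Import Order.TTheory GRing.Theory Num.Theory.

Local Open Scope classical_set_scope.
Local Open Scope ring_scope.

(** * Binary strings with one symbol changed *)

Fixpoint flip (j : nat) (s : seq bool) : seq bool :=
  match s, j with
  | [::], _ => [::]
  | b :: s', 0 => ~~ b :: s'
  | b :: s', j'.+1 => b :: flip j' s'
  end.

Lemma size_flip j s : size (flip j s) = size s.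
Proof. by elim: s j => [|b s IHs] [|j] //=; rewrite IHs. Qed.

Lemma flipK j : involutive (flip j).
Proof. by move=> s; elim: s j => [|b s IHs] [|j] //=; rewrite ?negbK ?IHs. Qed.

Lemma take_flip j s : take j (flip j s) = take j s.
Proof. by elim: s j => [|b s IHs] [|j] //=; rewrite IHs. Qed.

Canonical flip_tuple k j (u : k.-tuple bool) : k.-tuple bool :=
  @Tuple k bool (flip j u) (etrans (congr1 (eq_op^~ k) (size_flip j u)) (valP u)).

Lemma flip_tupleK k j : involutive (@flip_tuple k j).
Proof. by move=> u; apply: val_inj; rewrite /= flipK. Qed.

Lemma sum_tupleS (R : nmodType) k (F : seq bool -> R) :
  \sum_(u : k.+1.-tuple bool) F u =
  \sum_(u : k.-tuple bool) (F (true :: u) + F (false :: u)).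
Proof.
rewrite (reindex (fun p : bool * k.-tuple bool => [tuple of p.1 :: p.2])) /=.
  rewrite -(pair_bigA _ (fun a (u : k.-tuple bool) => F (a :: u))) /=.
  by rewrite big_bool -big_split.
exists (fun u : k.+1.-tuple bool => (thead u, [tuple of behead u])) => [[a u] _|u _] /=.
  by congr pair; apply: val_inj.
by rewrite -tuple_eta.
Qed.

(** * Noise acting on strings *)

Section Thinning.
Context (R : realFieldType) (eps : R).

(** The transition matrix of the noise: x is the true symbol, z the observed one. *)
Definition emit_prob (x z : bool) : R :=
  if x then (if z then 1 - eps else eps) else (~~ z)%:R.

Definition thin_prob (u w : seq bool) : R :=
  \prod_(p <- zip u w) emit_prob p.1 p.2.

Hypotheses (eps_gt0 : 0 < eps) (eps_lt1 : eps < 1).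

Lemma thin_prob_cons a b u w :
  thin_prob (a :: u) (b :: w) = emit_prob a b * thin_prob u w.
Proof. by rewrite /thin_prob /= big_cons. Qed.

Lemma emit_prob_ge0 a b : 0 <= emit_prob a b.
Proof. by case: a b => [] []; rewrite /= ?ler0n ?subr_ge0 ?ltW. Qed.

Lemma thin_prob_ge0 u w : 0 <= thin_prob u w.
Proof. by apply: prodr_ge0 => p _; exact: emit_prob_ge0. Qed.

Lemma thin_prob_diag_gt0 w : 0 < thin_prob w w.
Proof.
elim: w => [|b w IHw]; first by rewrite /thin_prob big_nil ltr01.
by rewrite thin_prob_cons mulr_gt0//; case: b; rewrite /= ?ltr01 ?subr_gt0.
Qed.

(** A mismatch has positive weight only when a true 1 is observed as 0, and then
    it costs a factor eps that a true 0 would not cost. *)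
Lemma thin_prob_flip j u w : size u = size w -> (j < size u)%N ->
  nth false u j != nth false w j ->
  thin_prob u w <= eps * thin_prob (flip j u) w.
Proof.
elim: u w j => [|a u IHu] [|b w] [|j] //= [uw] ju ne.
  rewrite !thin_prob_cons mulrA ler_wpM2r ?thin_prob_ge0//.
  by case: a b ne => [] [] //= _; rewrite ?mulr1n ?mulr0n ?mulr1// mulr_ge0 ?subr_ge0 ?ltW.
rewrite !thin_prob_cons mulrCA ler_wpM2l ?emit_prob_ge0//; exact: IHu.
Qed.

End Thinning.

(** * String laws with decaying memory, and their contamination *)

Section StringLaw.
Context (R : realFieldType) (mu : seq bool -> R) (alpha : R) (b : nat -> R).

Definition next_prob (a : bool) (u : seq bool) : R := mu (a :: u) / mu u.

Hypothesis mu_gt0 : forall u, 0 < mu u.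
Hypothesis mu_cons : forall u, mu u = mu (true :: u) + mu (false :: u).
Hypothesis alpha_gt0 : 0 < alpha.
Hypothesis alpha_le : forall a u, alpha <= next_prob a u.
Hypothesis b_ge0 : forall j, 0 <= b j.
Hypothesis b_lt1 : forall j, b j < 1.
(* The ratio form of the continuity rate: unlike a bound on differences, it can
   be multiplied along a string. *)
Hypothesis memory_loss : forall a j u v, size u = size v -> (j <= size u)%N ->
  take j u = take j v -> (1 - b j) * next_prob a v <= next_prob a u.

Lemma mu_ge0 u : 0 <= mu u. Proof. exact: ltW. Qed.

Lemma mu_next_prob a u : mu (a :: u) = next_prob a u * mu u.
Proof. by rewrite /next_prob divfK// gt_eqF. Qed.

Lemma next_prob_ge0 a u : 0 <= next_prob a u.
Proof. by rewrite /next_prob divr_ge0// ltW. Qed.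

Lemma next_probN a u : next_prob (~~ a) u = 1 - next_prob a u.
Proof.
apply/eqP; rewrite /next_prob eq_sym subr_eq -mulrDl.
suff -> : mu (~~ a :: u) + mu (a :: u) = mu u by rewrite divff// gt_eqF.
by rewrite (mu_cons u); case: a; rewrite // addrC.
Qed.

Lemma next_prob_le1 a u : next_prob a u <= 1.
Proof. by have := next_prob_ge0 (~~ a) u; rewrite next_probN; lra. Qed.

Lemma dist_next_prob a j u v : size u = size v -> (j <= size u)%N ->
  take j u = take j v -> `|next_prob a u - next_prob a v| <= b j.
Proof.
move=> uv ju tuv.
have hu := memory_loss a uv ju tuv.
have ju' : (j <= size v)%N by rewrite -uv.
have hv := memory_loss a (esym uv) ju' (esym tuv).
rewrite ler_norml; apply/andP; split.
  have : b j * next_prob a v <= b j by rewrite ler_piMr ?next_prob_le1.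
  lra.
have : b j * next_prob a u <= b j by rewrite ler_piMr ?next_prob_le1.
lra.
Qed.

(** Summing over all mismatches instead of the first one only enlarges the bound,
    and makes it linear in the mismatch indicators, so that it can be averaged
    position by position. *)
Lemma dist_next_prob_sum a u w : size u = size w ->
  `|next_prob a u - next_prob a w| <=
  \sum_(j < size w | nth false u j != nth false w j) b j.
Proof.
move=> uw; have [->|neq] := eqVneq u w.
  by rewrite subrr normr0 sumr_ge0.
have [j /andP[jw nej] jmin] : {j | (j < size w)%N && (nth false u j != nth false w j)
    & forall i, (i < size w)%N && (nth false u i != nth false w i) -> (j <= i)%N}.
  have ex : exists j, (j < size w)%N && (nth false u j != nth false w j).
    have /hasP[j] : has (fun j => nth false u j != nth false w j) (iota 0 (size w)).
      apply: contraNT neq => /hasPn eq_uw; apply/eqP.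
      apply: (@eq_from_nth _ false) => // i iu; apply/eqP/negPn/eq_uw.
      by rewrite mem_iota -uw.
    by rewrite mem_iota => jw nej; exists j; apply/andP.
  by case: (ex_minnP ex) => j; exists j.
rewrite (bigD1 (Ordinal jw)) //= -[leLHS]addr0 lerD ?sumr_ge0//.
apply: dist_next_prob => //; first by rewrite uw ltnW.
apply: (@eq_from_nth _ false); first by rewrite !size_take uw.
move=> i; rewrite size_take uw jw => ij; rewrite !nth_take//.
apply/eqP/negPn/negP => ne.
have := jmin i; rewrite ne andbT (ltn_trans ij jw) => /(_ isT).
by rewrite leqNgt ij.
Qed.

(** The two-sided conditional probability of a symbol is bounded below: in the
    product of one-sided conditional probabilities, the factor at position j is at
    least alpha after the change, and that of the symbol at position j - 1 - i,
    whose past is unchanged on its i first entries, loses at most 1 - b i. *)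
Lemma mu_flip j u : (j < size u)%N ->
  alpha * \prod_(0 <= i < j) (1 - b i) * mu u <= mu (flip j u).
Proof.
elim: u j => [|a u IHu] // [|j] /= ju.
  rewrite big_geq// mulr1 !mu_next_prob mulrA ler_wpM2r ?mu_ge0//.
  apply: le_trans (alpha_le (~~ a) u).
  by rewrite ler_piMr ?next_prob_le1 ?(ltW alpha_gt0).
rewrite big_nat_recr//= !mu_next_prob.
have IH := IHu j ju.
have close : (1 - b j) * next_prob a u <= next_prob a (flip j u).
  by apply: memory_loss; rewrite ?size_flip ?take_flip// ltnW.
apply: le_trans (ler_wpM2l (next_prob_ge0 _ _) IH).
rewrite [leLHS](_ : _ = (1 - b j) * next_prob a u *
  (alpha * \prod_(0 <= i < j) (1 - b i) * mu u)); last by ring.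
rewrite ler_wpM2r// !mulr_ge0 ?mu_ge0 ?(ltW alpha_gt0)// prodr_ge0// => i _.
by rewrite subr_ge0 ltW.
Qed.

Context (eps delta : R).
Hypotheses (eps_gt0 : 0 < eps) (eps_lt1 : eps < 1) (delta_gt0 : 0 < delta).
Hypothesis delta_le : forall j, delta <= alpha * \prod_(0 <= i < j) (1 - b i).

(** The law of the observed strings when a string drawn from mu passes through the
    noise. *)
Definition thinned_law (k : nat) (w : seq bool) : R :=
  \sum_(u : k.-tuple bool) mu u * thin_prob eps u w.

Lemma thinned_law_cons k a w : thinned_law k.+1 (a :: w) =
  \sum_(u : k.-tuple bool) (mu (true :: u) * emit_prob eps true a +
    mu (false :: u) * emit_prob eps false a) * thin_prob eps u w.
Proof.
rewrite /thinned_law (sum_tupleS k (fun u => mu u * thin_prob eps u (a :: w))).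
by apply: eq_bigr => u _; rewrite !thin_prob_cons !mulrA -mulrDl.
Qed.

Lemma thinned_law_next k w :
  thinned_law k w = thinned_law k.+1 (true :: w) + thinned_law k.+1 (false :: w).
Proof.
rewrite !thinned_law_cons -big_split; apply: eq_bigr => u _ /=.
by rewrite mu_cons; ring.
Qed.

Lemma thinned_law_gt0 k (w : k.-tuple bool) : 0 < thinned_law k w.
Proof.
rewrite /thinned_law (bigD1 w)//= ltr_wpDr ?sumr_ge0//.
  by move=> u _; rewrite mulr_ge0 ?thin_prob_ge0 ?mu_ge0.
by rewrite mulr_gt0 ?thin_prob_diag_gt0.
Qed.

(** Pair each true string u that mismatches w at j with [flip j u]: u has at
    most eps times the noise weight of its partner ([thin_prob_flip]) and at most
    1 / delta times its probability ([mu_flip]), and the partners together carry at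
    most the total mass. *)
Lemma thinned_law_mismatch k (w : k.-tuple bool) j : (j < k)%N ->
  \sum_(u : k.-tuple bool | nth false u j != nth false w j)
     mu u * thin_prob eps u w <= eps / delta * thinned_law k w.
Proof.
move=> jk; rewrite /thinned_law mulr_sumr.
rewrite [leRHS](reindex_inj (inv_inj (@flip_tupleK k j))) /=.
rewrite [leRHS](bigID (fun u : k.-tuple bool => nth false u j != nth false w j)) /=.
have ge0 (u : k.-tuple bool) : 0 <= eps / delta * (mu (flip j u) * thin_prob eps (flip j u) w).
  by rewrite !mulr_ge0 ?thin_prob_ge0 ?mu_ge0 ?invr_ge0 ?ltW.
rewrite -[leLHS]addr0 lerD ?sumr_ge0//; apply: ler_sum => u ne.
rewrite [leRHS](_ : _ = (mu (flip j u) / delta) * (eps * thin_prob eps (flip j u) w)); last by ring.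
apply: ler_pM; rewrite ?mu_ge0 ?thin_prob_ge0//.
- by rewrite ler_pdivlMr// mulrC (le_trans _ (mu_flip _)) ?size_tuple// ler_wpM2r ?mu_ge0.
- by apply: thin_prob_flip; rewrite ?size_tuple.
Qed.

(** Dividing by [thinned_law k w] turns the sum into the probability of the next
    true symbol given the observed past w, that is, the mean of [next_prob a u]
    over true pasts u. *)
Lemma thinned_past_next_prob k (w : k.-tuple bool) a :
  `|\sum_(u : k.-tuple bool) mu (a :: u) * thin_prob eps u w -
    next_prob a w * thinned_law k w| <=
  (\sum_(j < k) b j) * (eps / delta) * thinned_law k w.
Proof.
have -> : \sum_(u : k.-tuple bool) mu (a :: u) * thin_prob eps u w -
    next_prob a w * thinned_law k w =
  \sum_(u : k.-tuple bool) (next_prob a u - next_prob a w) *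
    (mu u * thin_prob eps u w).
  rewrite /thinned_law mulr_sumr -sumrB; apply: eq_bigr => u _.
  by rewrite mu_next_prob; ring.
apply: le_trans (ler_norm_sum _ _ _) _.
have weight_ge0 (u : k.-tuple bool) : 0 <= mu u * thin_prob eps u w.
  by rewrite mulr_ge0 ?thin_prob_ge0 ?mu_ge0.
apply: (@le_trans _ _ (\sum_(u : k.-tuple bool)
    (\sum_(j < k | nth false u j != nth false w j) b j) * (mu u * thin_prob eps u w))).
  apply: ler_sum => u _; rewrite normrM (ger0_norm (weight_ge0 u)) ler_wpM2r//.
  have := @dist_next_prob_sum a u w; rewrite !size_tuple; exact.
under eq_bigr => u _ do rewrite mulr_suml big_mkcond /=.
rewrite exchange_big /= -mulrA mulr_suml ler_sum// => j _.
rewrite -big_mkcond /= -mulr_sumr ler_wpM2l//.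
exact: thinned_law_mismatch.
Qed.

(** Two errors add up: the noise at time 0 erases the next symbol with probability
    eps, which accounts for the term 1, and the observed past is not the true one,
    which accounts for the sum. *)
Lemma dist_thinned_next_prob k (w : k.-tuple bool) a :
  `|thinned_law k.+1 (a :: w) / thinned_law k w - next_prob a w| <=
  eps * (1 + (1 - eps) * (\sum_(j < k) b j) / delta).
Proof.
(* The probabilities of the two symbols add up to 1 in both laws, so their errors
   are opposite. *)
wlog -> : a / a = true.
  move=> H; case: a; first exact: H.
  have := H true erefl; rewrite distrC (next_probN true w : next_prob false w = _).
  have -> : thinned_law k.+1 (false :: w) / thinned_law k w =
      1 - thinned_law k.+1 (true :: w) / thinned_law k w.
    rewrite -(divff (lt0r_neq0 (thinned_law_gt0 w))) -mulrBl.
    by congr (_ / _); rewrite (thinned_law_next k w); ring.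
  congr (`|_| <= _); ring.
have nu_gt0 := thinned_law_gt0 w.
have -> : thinned_law k.+1 (true :: w) =
    (1 - eps) * \sum_(u : k.-tuple bool) mu (true :: u) * thin_prob eps u w.
  by rewrite thinned_law_cons mulr_sumr; apply: eq_bigr => u _ /=; ring.
set S := \sum_(u : _) _; set nu := thinned_law k w in nu_gt0 *.
have -> : (1 - eps) * S / nu - next_prob true w =
    (1 - eps) * ((S - next_prob true w * nu) / nu) - eps * next_prob true w.
  by field; rewrite gt_eqF.
apply: le_trans (ler_normB _ _) _.
rewrite [in leRHS]mulrDr mulr1 [leLHS]addrC lerD//.
  rewrite normrM (gtr0_norm eps_gt0) (ger0_norm (next_prob_ge0 _ _)).
  by rewrite ler_piMr ?next_prob_le1 ?(ltW eps_gt0).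
rewrite normrM ger0_norm ?subr_ge0 ?(ltW eps_lt1)// normrM normfV (gtr0_norm nu_gt0).
rewrite [leRHS](_ : _ = (1 - eps) * ((\sum_(j < k) b j) * (eps / delta))); last by ring.
rewrite ler_wpM2l ?subr_ge0 ?(ltW eps_lt1)// ler_pdivrMr//.
exact: thinned_past_next_prob.
Qed.

End StringLaw.

(** * Transition kernels and their continuity rates *)

Section KernelRates.
Context (R : realType) (p : R.-pker pasts ~> bool).

Lemma transK a w : (trans p a w)%:E = p w [set a].
Proof.
rewrite /trans fineK// ge0_fin_numE// (@le_lt_trans _ _ (p w setT))//.
  by apply: le_measure; rewrite ?inE.
by rewrite prob_kernel ltry.
Qed.

Lemma trans_ge0 a w : 0 <= trans p a w.
Proof. exact: fine_ge0. Qed.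

Lemma trans_le1 a w : trans p a w <= 1.
Proof.
rewrite -lee_fin transK -(prob_kernel (s := p) w).
by apply: le_measure; rewrite ?inE.
Qed.

Lemma alpha_le_trans a w : alpha p <= trans p a w.
Proof.
apply: ge_inf; last by exists a, w.
by exists 0 => _ [b [v ->]]; exact: trans_ge0.
Qed.

Hypothesis alpha_gt0 : 0 < alpha p.

Lemma trans_gt0 a w : 0 < trans p a w.
Proof. exact: lt_le_trans (alpha_le_trans a w). Qed.

(** [1 / alpha] bounds the ratios, so the supremum in [beta_] is over a bounded set. *)
Lemma ratio_le_beta k a w v : (forall i, (i < k)%N -> w i = v i) ->
  `|1 - trans p a w / trans p a v| <= beta_ p k.
Proof.
move=> wv; apply: ub_le_sup; last by exists a, w, v.
exists (1 + (alpha p)^-1) => _ [c [x [y [_ ->]]]].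
apply: le_trans (ler_normB _ _) _; rewrite normr1 lerD2l.
rewrite ger0_norm ?divr_ge0 ?trans_ge0// -[leRHS]mul1r.
by rewrite ler_pM ?invr_ge0 ?trans_ge0 ?trans_le1// lef_pV2 ?posrE ?trans_gt0 ?alpha_le_trans.
Qed.

Lemma beta_ge0 k : 0 <= beta_ p k.
Proof.
have := @ratio_le_beta k true (fun=> true) (fun=> true) (fun _ _ => erefl).
exact: le_trans.
Qed.

Lemma trans_memory_loss k a w v : (forall i, (i < k)%N -> w i = v i) ->
  (1 - beta_ p k) * trans p a v <= trans p a w.
Proof.
move=> /(ratio_le_beta a) /ler_normlP[_ h].
by rewrite -ler_pdivlMr ?trans_gt0//; lra.
Qed.

Lemma sum_beta_le k : (beta p < +oo)%E -> \sum_(j < k) beta_ p j <= fine (beta p).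
Proof.
move=> beta_fin.
have beta0 n : (0 <= (beta_ p n)%:E)%E by rewrite lee_fin beta_ge0.
rewrite -lee_fin fineK; last by rewrite ge0_fin_numE// nneseries_ge0.
by rewrite -sumEFin -(big_mkord xpredT (fun j => (beta_ p j)%:E)) nneseries_lim_ge.
Qed.

Lemma beta_star_le j : (forall k, beta_ p k < 1) ->
  beta_star p <= \prod_(0 <= i < j) (1 - beta_ p i).
Proof.
move=> beta_lt1.
have prod_ge0 n : 0 <= \prod_(0 <= i < n) (1 - beta_ p i).
  by rewrite prodr_ge0// => i _; rewrite subr_ge0 ltW.
have prod_ni : nonincreasing_seq (fun n => \prod_(0 <= i < n) (1 - beta_ p i)).
  apply/nonincreasing_seqP => n; rewrite big_nat_recr//= ler_piMr//.
  by rewrite gerBl beta_ge0.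
apply: (nonincreasing_cvgn_ge prod_ni); apply: nonincreasing_is_cvgn => //.
by exists 0 => _ [n _ <-].
Qed.

End KernelRates.

(** * Measurability of cylinders *)

Lemma measurable_coord (I : Type) (i : I) :
  measurable_fun setT (fun w : binspace I => w i).
Proof.
apply: (measurable_fun_bool true); rewrite setTI.
by apply: sub_sigma_algebra; exists i, true.
Qed.

Lemma measurable_cylinder (I : Type) (n : nat) (t : nat -> I) (A : nat -> set bool) :
  measurable [set w : binspace I | forall i, (i < n)%N -> A i (w (t i))].
Proof.
rewrite [X in measurable X](_ : _ =
  \bigcap_(i in `I_n) ((fun w : binspace I => w (t i)) @^-1` A i)) //.
apply: bigcap_measurableType => i _; rewrite -[X in measurable X]setTI.
exact: measurable_coord.
Qed.

Lemma measurable_coordwise d (T : measurableType d) (I : Type) (f : T -> binspace I) :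
  (forall i, measurable_fun setT (fun x => f x i)) -> measurable_fun setT f.
Proof.
move=> mf; apply: (@measurability _ _ _ _ setT f (cylinders I)) => // _ [_ [i [b ->]] <-].
by apply: (mf i measurableT [set b]).
Qed.

(** * Strings of a binary process *)

Section Strings.
Context (d : measure_display) (T : measurableType d) (R : realType).
Context (P : probability T R).

(** The most recent symbol comes first, at time t, as in the encoding of pasts:
    consing adds a present symbol to a past, so that strings can be treated by
    induction along the conditional probabilities. *)
Definition string_at (Y : int -> T -> bool) (t : int) (s : seq bool) : set T :=
  [set x | forall i, (i < size s)%N -> Y (t - i%:Z) x = nth false s i].

Definition string_prob (Y : int -> T -> bool) (s : seq bool) : R :=
  fine (P (string_at Y 0 s)).

Lemma string_at_cons Y t a s :
  string_at Y t (a :: s) = Y t @^-1` [set a] `&` string_at Y (t - 1) s.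
Proof.
have timeE i : t - i.+1%:Z = t - 1 - i%:Z :> int by rewrite intS opprD addrA.
apply/seteqP; split=> [x H|x [/= H0 Hs] [|i] si].
- split=> [|i si]; first by have := H 0 isT; rewrite subr0.
  by rewrite -timeE; exact: H i.+1 si.
- by rewrite subr0.
- by rewrite timeE; exact: Hs.
Qed.

Lemma string_atE Y t s : string_at Y t s = trajectory Y @^-1`
  [set w : binspace int | forall i, (i < size s)%N -> w (t - i%:Z) = nth false s i].
Proof. by []. Qed.

Section Measurability.
Context (Y : int -> T -> bool).
Hypothesis mY : forall t, measurable_fun setT (Y t).

Lemma measurable_trajectory (B : set (binspace int)) :
  measurable B -> measurable (trajectory Y @^-1` B).
Proof.
by move=> mB; rewrite -[X in measurable X]setTI; exact: (measurable_coordwise mY).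
Qed.

Lemma measurable_past : measurable_fun setT (past Y).
Proof. by apply: measurable_coordwise => i; exact: mY. Qed.

Lemma measurable_string t s : measurable (string_at Y t s).
Proof.
rewrite string_atE; apply: measurable_trajectory.
exact: (@measurable_cylinder int (size s) (fun i => t - i%:Z) (fun i => [set nth false s i])).
Qed.

Lemma measurable_letter t a : measurable (Y t @^-1` [set a]).
Proof. by rewrite -[X in measurable X]setTI; exact: mY. Qed.

Lemma prob_split t E : measurable E -> fine (P E) =
  fine (P (E `&` Y t @^-1` [set true])) + fine (P (E `&` Y t @^-1` [set false])).
Proof.
move=> mE; have mEa a := measurableI _ _ mE (measurable_letter t a).
rewrite -fineD ?fin_num_measure// -measureU//.
  congr (fine (P _)); rewrite -setIUr -preimage_setU -[LHS]setIT.
  by congr (_ `&` _); apply/seteqP; split=> // x _ /=; case: (Y t x); [left|right].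
by rewrite -subset0 => x [[_ /= ->] [_ ]].
Qed.

Lemma prob_string_partition k t E : measurable E ->
  fine (P E) = \sum_(u : k.-tuple bool) fine (P (E `&` string_at Y t u)).
Proof.
elim: k t E => [|k IHk] t E mE.
  rewrite (eq_bigr (fun=> fine (P E))) => [|u _].
    by rewrite sumr_const card_tuple.
  by rewrite tuple0; congr (fine (P _)); apply/seteqP; split=> [x []|x Ex].
rewrite (sum_tupleS k (fun u => fine (P (E `&` string_at Y t u)))) big_split.
rewrite (prob_split t mE) /=; congr (_ + _).
  rewrite (IHk (t - 1)); last exact/measurableI/measurable_letter.
  by apply: eq_bigr => u _; rewrite string_at_cons setIA.
rewrite (IHk (t - 1)); last exact/measurableI/measurable_letter.
by apply: eq_bigr => u _; rewrite string_at_cons setIA.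
Qed.

Lemma string_prob_past s :
  fine (P (string_at Y (-1) s)) =
  string_prob Y (true :: s) + string_prob Y (false :: s).
Proof.
rewrite (prob_split 0 (measurable_string (-1) s)) /string_prob !string_at_cons sub0r.
by rewrite ![_ `&` string_at _ _ _]setIC.
Qed.

End Measurability.

Lemma past_isE Y k (w : k.-tuple bool) : past_is Y w = string_at Y (-1) w.
Proof.
have timeE i : -1 - i%:Z = - i.+1%:Z :> int by rewrite intS opprD.
apply/seteqP; split=> x /= H i.
  by rewrite size_tuple => ik; rewrite timeE -(tnth_nth _ _ (Ordinal ik)) -H.
by rewrite (tnth_nth false) -H ?size_tuple// timeE.
Qed.

Lemma cond_probE Y k (w : k.-tuple bool) a : cond_prob P Y w a =
  string_prob Y (a :: w) / fine (P (string_at Y (-1) w)).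
Proof. by rewrite /cond_prob /string_prob past_isE string_at_cons sub0r. Qed.

Lemma stationary_string (Y : int -> T -> bool) s : stationary P Y ->
  fine (P (string_at Y (-1) s)) = string_prob Y s.
Proof.
move=> Y_stationary; rewrite /string_prob !string_atE.
have mcyl := @measurable_cylinder int (size s) (fun i => -1 - i%:Z) (fun i => [set nth false s i]).
rewrite -(Y_stationary _ mcyl); congr (fine (P _)); apply/seteqP.
have timeE i : -1 - i%:Z + 1 = 0 - i%:Z :> int by ring.
split=> x H i si; first by rewrite -timeE; exact: H i si.
by rewrite /Defs.shift timeE; exact: H i si.
Qed.

End Strings.

(** * Strings of a stationary process with a given conditional law *)

Section ConditionalLaw.
Context (d : measure_display) (T : measurableType d) (R : realType).
Context (P : probability T R) (Y : int -> T -> bool) (p : R.-pker pasts ~> bool).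
Hypothesis mY : forall t, measurable_fun setT (Y t).
Hypothesis Y_stationary : stationary P Y.
Hypothesis Y_cond : is_cond_law P Y p.

Definition extends (s : seq bool) : set pasts :=
  [set v | forall i, (i < size s)%N -> v i = nth false s i].

Lemma string_at_extends s : string_at Y (-1) s = past Y @^-1` extends s.
Proof.
have timeE i : -1 - i%:Z = - i.+1%:Z :> int by rewrite intS opprD.
by apply/seteqP; split=> x H i si; [rewrite /past -timeE | rewrite timeE]; exact: H.
Qed.

Lemma string_prob_integral a s : (string_prob P Y (a :: s))%:E =
  (\int[P]_(x in string_at Y (-1) s) p (past Y x) [set a])%E.
Proof.
rewrite /string_prob fineK ?fin_num_measure//; last exact: measurable_string.
rewrite string_at_cons sub0r string_at_extends Y_cond//.
exact: (@measurable_cylinder nat (size s) id (fun i => [set nth false s i])).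
Qed.

Lemma measurable_trans_past a D :
  measurable_fun D (fun x => p (past Y x) [set a] : \bar R).
Proof.
apply: measurable_funTS; apply: (measurableT_comp (measurable_kernel p [set a] _)) => //.
exact: measurable_past.
Qed.

(** A string probability is the integral of the kernel over the cylinder of pasts,
    so pointwise bounds on that cylinder pass to it.  In product form the bound also
    yields the positivity of string probabilities, by induction on the string. *)
Lemma string_prob_ge a s l : 0 <= l ->
  (forall v, extends s v -> l <= trans p a v) ->
  l * string_prob P Y s <= string_prob P Y (a :: s).
Proof.
move=> l0 lev; have mS := measurable_string mY (-1) s.
rewrite -(stationary_string s Y_stationary) -lee_fin string_prob_integral.
rewrite EFinM fineK ?fin_num_measure//.
rewrite -integral_cst//; apply: ge0_le_integral => //=.
  exact: measurable_trans_past.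
move=> x; rewrite string_at_extends => /lev.
by rewrite -lee_fin transK.
Qed.

Lemma string_prob_le a s h : 0 <= h ->
  (forall v, extends s v -> trans p a v <= h) ->
  string_prob P Y (a :: s) <= h * string_prob P Y s.
Proof.
move=> h0 leh; have mS := measurable_string mY (-1) s.
rewrite -(stationary_string s Y_stationary) -lee_fin string_prob_integral.
rewrite EFinM fineK ?fin_num_measure//.
rewrite -integral_cst//; apply: ge0_le_integral => //=.
  exact: measurable_trans_past.
move=> x; rewrite string_at_extends => /leh.
by rewrite -lee_fin transK.
Qed.

Lemma string_prob_cons s :
  string_prob P Y s = string_prob P Y (true :: s) + string_prob P Y (false :: s).
Proof. by rewrite -(stationary_string _ Y_stationary) (string_prob_past P mY). Qed.

Hypothesis alpha_gt0 : 0 < alpha p.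

Lemma string_prob_gt0 s : 0 < string_prob P Y s.
Proof.
elim: s => [|a s IHs].
  rewrite /string_prob (_ : string_at _ _ _ = setT) ?probability_setT ?ltr01//.
  exact/seteqP.
apply: lt_le_trans (string_prob_ge (ltW alpha_gt0) (fun v _ => alpha_le_trans p a v)).
by rewrite mulr_gt0.
Qed.

Lemma alpha_le_next_prob a s : alpha p <= next_prob (string_prob P Y) a s.
Proof.
rewrite ler_pdivlMr ?string_prob_gt0//.
by apply: string_prob_ge (ltW alpha_gt0) _ => v _; exact: alpha_le_trans.
Qed.

Hypothesis beta_lt1 : forall k, beta_ p k < 1.

(** The conditional probability given a finite string lies between the extrema of
    the kernel over the pasts extending the string, so the ratio bound between
    pasts extending w and pasts extending u passes to the strings. *)
Lemma next_prob_memory_loss a j u w : size u = size w -> (j <= size u)%N ->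
  take j u = take j w ->
  (1 - beta_ p j) * next_prob (string_prob P Y) a w <= next_prob (string_prob P Y) a u.
Proof.
move=> uw ju tuw; have b1 : 0 < 1 - beta_ p j by rewrite subr_gt0.
have mu_gt0 := string_prob_gt0.
rewrite mulrC -ler_pdivlMr// ler_pdivrMr//.
apply: string_prob_le => [|y wy]; first by rewrite !divr_ge0 ?ltW.
rewrite ler_pdivlMr// mulrC ler_pdivlMr//.
apply: string_prob_ge => [|x ux]; first by rewrite mulr_ge0 ?trans_ge0 ?ltW.
apply: trans_memory_loss => // i ij.
have iu := leq_trans ij ju.
by rewrite ux // wy -?uw// -(nth_take _ ij) tuw nth_take.
Qed.

End ConditionalLaw.

(** * The law of the contaminated strings *)

Section Noise.
Context (d : measure_display) (T : measurableType d) (R : realType).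
Context (P : probability T R) (eps : R) (xi : int -> T -> bool).
Hypothesis mxi : forall t, measurable_fun setT (xi t).
Hypothesis xi_indep : mutually_independent P xi.
Hypothesis xi_law : forall t, P (xi t @^-1` [set true]) = (1 - eps)%:E.

Lemma prob_emit t a c :
  P (xi t @^-1` [set b | (a && b) = c]) = (emit_prob eps a c)%:E.
Proof.
case: a c => [] [] /=.
- exact: xi_law.
- have -> : xi t @^-1` [set b | b = false] = ~` (xi t @^-1` [set true]).
    by apply/seteqP; split=> x /=; case: (xi t x).
  rewrite probability_setC; last exact: measurable_letter.
  by rewrite xi_law -EFinB opprB addrC subrK.
- have -> : xi t @^-1` [set b | false = true] = set0 by apply/seteqP; split.
  by rewrite measure0.
- have -> : xi t @^-1` [set b | false = false] = setT by apply/seteqP; split.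
  by rewrite probability_setT.
Qed.

Definition thins_to (u w : seq bool) : set T :=
  [set x | forall i, (i < size w)%N ->
    (nth false u i && xi (0 - i%:Z) x) = nth false w i].

Lemma prob_thins_to u w : size u = size w ->
  P (thins_to u w) = (thin_prob eps u w)%:E.
Proof.
move=> uw.
(* The constraint at time t is the one at index |t|, since times are 0, -1, ... *)
pose A (t : int) := [set b | (nth false u `|t|%N && b) = nth false w `|t|%N].
pose s := [seq 0 - i%:Z | i <- iota 0 (size w)].
have absE (i : nat) : `|0 - i%:Z|%N = i by rewrite sub0r abszN absz_nat.
have s_uniq : uniq s.
  by rewrite map_inj_uniq ?iota_uniq// => i j /(congr1 absz); rewrite !absE.
have -> : thins_to u w = [set x | forall t, t \in s -> A t (xi t x)].
  apply/seteqP; split=> x H.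
    by move=> t /mapP[i]; rewrite mem_iota => /= iw ->; rewrite /A/= absE; exact: H.
  move=> i iw; have := H (0 - i%:Z); rewrite /A/= absE; apply.
  by apply: map_f; rewrite mem_iota.
rewrite xi_indep// big_map /thin_prob (big_nth (false, false)) size_zip uw minnn.
rewrite /index_iota subn0 -prodEFin; apply: eq_bigr => i _.
by rewrite nth_zip//= /A absE prob_emit.
Qed.

Context (X : int -> T -> bool).
Hypothesis mX : forall t, measurable_fun setT (X t).
Hypothesis X_xi_indep : independent_processes P X xi.

Lemma measurable_zero_inflated t : measurable_fun setT (zero_inflated X xi t).
Proof. exact: measurable_and. Qed.

(** Once the string u read by X is fixed, the observed string depends on the noise
    alone, which is independent of u. *)
Lemma string_prob_zero_inflated k s : size s = k ->
  string_prob P (zero_inflated X xi) s = thinned_law (string_prob P X) eps k s.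
Proof.
move=> sk; rewrite /string_prob (prob_string_partition P mX k 0); last first.
  exact: (measurable_string measurable_zero_inflated).
apply: eq_bigr => u _; have us : size u = size s by rewrite size_tuple.
have -> : string_at (zero_inflated X xi) 0 s `&` string_at X 0 u =
    string_at X 0 u `&` thins_to u s.
  apply/seteqP; split=> x [Hz Hu]; split=> // i si.
    by rewrite -Hu ?us//; exact: Hz.
  by rewrite /zero_inflated Hz ?us//; exact: Hu.
have mB := @measurable_cylinder int (size u) (fun i => 0 - i%:Z)
  (fun i => [set nth false u i]).
have mC := @measurable_cylinder int (size s) (fun i => 0 - i%:Z)
  (fun i => [set b | (nth false u i && b) = nth false s i]).
have -> : P (string_at X 0 u `&` thins_to u s) =
    (P (string_at X 0 u) * P (thins_to u s))%E by exact: X_xi_indep mB mC.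
by rewrite prob_thins_to// fineM// fin_num_measure//; exact: measurable_string.
Qed.

End Noise.

(** * The bound *)

Theorem theorem3p1 (d : measure_display) (T : measurableType d) (R : realType)
    (P : probability T R)
    (X xi : int -> {RV P >-> bool})
    (X_stationary : stationary P X)
    (X_ergodic : ergodic P X)
    (pX : R.-pker pasts ~> bool)
    (pX_cond : is_cond_law P X pX)
    (X_nonnull : 0 < alpha pX)
    (X_summable : (beta pX < +oo)%E)
    (beta_lt1 : forall k, beta_ pX k < 1)
    (beta_star_gt0 : 0 < beta_star pX)
    (eps : R) (eps_gt0 : 0 < eps) (eps_lt1 : eps < 1)
    (xi_indep : mutually_independent P xi)
    (xi_law : forall t, P (xi t @^-1` [set true]) = (1 - eps)%:E)
    (X_xi_indep : independent_processes P X xi) :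
  let Z := zero_inflated X xi in
  (ereal_sup [set
     ereal_sup [set
       ereal_sup [set
         (`|cond_prob P Z w a - cond_prob P X w a|)%:E
       | a in [set: bool]]
     | w in [set: k.-tuple bool]]
   | k in [set k | (1 <= k)%N]]
   <= (eps * (1 + 4 * fine (beta pX)
                  / Num.min 1 ((1 + eps) * alpha pX * beta_star pX)))%:E)%E.
Proof.
cbv zeta; set Z := zero_inflated X xi.
apply: ge_ereal_sup => _ [k _ <-]; apply: ge_ereal_sup => _ [w _ <-].
apply: ge_ereal_sup => _ [a _ <-]; rewrite lee_fin.
have mX t : measurable_fun setT (X t) by exact: measurable_funPT.
have mxi t : measurable_fun setT (xi t) by exact: measurable_funPT.
have mZ := measurable_zero_inflated mxi mX.
have Z_law s := string_prob_zero_inflated mxi xi_indep xi_law mX X_xi_indep (erefl (size s)).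
rewrite !cond_probE (stationary_string w X_stationary) (string_prob_past P mZ).
rewrite !Z_law /= !size_tuple -thinned_law_next; last first.
  exact: (string_prob_cons mX X_stationary).
have ab_gt0 : 0 < alpha pX * beta_star pX by rewrite mulr_gt0.
apply: (le_trans (@dist_thinned_next_prob R (string_prob P X) (alpha pX) (beta_ pX)
  _ _ _ _ _ _ _ eps (alpha pX * beta_star pX) _ _ _ _ k w a)) => //.
- exact: string_prob_gt0 pX_cond _.
- exact: string_prob_cons.
- exact: alpha_le_next_prob.
- exact: beta_ge0.
- exact: next_prob_memory_loss.
- by move=> j; rewrite ler_pM2l// beta_star_le.
rewrite ler_pM2l// lerD2l; set delta := alpha pX * beta_star pX in ab_gt0 *.
have sum_le := sum_beta_le X_nonnull k X_summable.
have sum_ge0 : 0 <= \sum_(j < k) beta_ pX j by rewrite sumr_ge0// => j _; rewrite beta_ge0.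
set S := \sum_(j < k) _ in sum_le sum_ge0 *; set B := fine _ in sum_le *.
have B_ge0 : 0 <= B by exact: le_trans sum_le.
rewrite -(mulrA _ (alpha pX)) -/delta.
set m := Num.min _ _.
have m_gt0 : 0 < m by rewrite lt_min ltr01 mulr_gt0// addr_gt0.
have m_le : m <= (1 + eps) * delta by rewrite ge_min lexx orbT.
rewrite ler_pdivrMr// mulrAC ler_pdivlMr//.
have step : (1 - eps) * S * m <= (1 - eps) * B * ((1 + eps) * delta).
  by rewrite ler_pM ?ler_wpM2l ?mulr_ge0 ?subr_ge0// ltW.
(* The constant 4 exceeds (1 - eps) (1 + eps) by exactly 3 + eps ^+ 2. *)
have slack : 0 <= B * delta * (3 + eps ^+ 2).
  by apply: mulr_ge0; [exact: mulr_ge0 (ltW ab_gt0) | rewrite addr_ge0 ?sqr_ge0].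
lra.
Qed.
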